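(* Let $K$ be a field containing $\mathbb{F}_q$, $W\subset K$ an $\mathbb{F}_q$-subspace with $\dim_{\mathbb{F}_q}W=n\ge1$, $\underline w=(w_1,\dots,w_n)$ an $\mathbb{F}_q$-basis of $W$, and $U\subset K$ the $\mathbb{F}_q$-space of roots of the reversed polynomial of $P_W(X)=\prod_{x\in W}(X-x)$. Let $E:W\times U\to\mathbb{F}_q$ be the Elkies pairing and $f:W\times U\to\mathbb{F}_q$ the residue pairing (both defined in the context). Then $E(w,u)=f(w,u)$ for all $(w,u)\in W\times U$.
   Context: $q=p^s$ is a power of a prime $p$. For $\underline a=(a_1,\dots,a_n)$ in a commutative ring containing $\mathbb{F}_q$, $\Delta_n(\underline a):=\det\big(a_j^{q^{i-1}}\big)_{1\le i,j\le n}$ is the Moore determinant, with $\Delta_0:=1$; $\underline{\hat w_i}$ is $\underline w$ with $w_i$ omitted. Write $P_W(X)=\prod_{x\in W}(X-x)=\sum_{m=0}^nc_mX^{q^m}$, with $c_n=1$. Its reversed polynomial is $(\rho P_W)(X):=\sum_{m=0}^nc_{n-m}^{q^m}X^{q^m}$. By a known theorem of Ore, the roots of $\rho P_W$ form the $n$-dimensional $\mathbb{F}_q$-subspace $U=\{(x/\Delta_n(\underline w))^q : x\in\hat W\}$ of $K$, where $\hat W:=\bigoplus_{i=1}^n\mathbb{F}_q\,\Delta_{n-1}(\underline{\hat w_i})$ (the elements $\Delta_{n-1}(\underline{\hat w_i})$ are $\mathbb{F}_q$-linearly independent, and $\Delta_n(\underline w)\ne0$). Elkies pairing: for $(w,u)\in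 W\times U$, $$E(w,u):=\sum_{m=1}^n\sum_{j=0}^{m-1}\big((c_mu)^{q^{-m}}w\big)^{q^j},$$ where $q^{-m}$-th powers (i.e. $q^m$-th roots) are taken in an algebraic closure of $K$; it is known that $E(w,u)\in\mathbb{F}_q$. Residue pairing: each $u\in U$ is written uniquely as $u=\big(\delta_\varphi(\underline w)/\Delta_n(\underline w)\big)^q$ with $\delta_\varphi(\underline w)=\sum_{i=1}^n\alpha_i(-1)^{i-1}\Delta_{n-1}(\underline{\hat w_i})$, $(\alpha_1,\dots,\alpha_n)\in\mathbb{F}_q^n$. Let $$\omega_\varphi:=\sum_{(\epsilon_1,\dots,\epsilon_n)\in\mathbb{F}_q^n}\frac{\sum_{j=1}^n\alpha_j\epsilon_j}{X-\sum_{i=1}^n\epsilon_iw_i}\,dX .$$ For $w=\sum_{i=1}^n\epsilon_i(w)w_i\in W$ with $\epsilon_i(w)\in\mathbb{F}_q$, define $$f(w,u):=(-1)^{n-1}\operatorname{res}_w\omega_\varphi=(-1)^{n-1}\sum_{j=1}^n\alpha_j\epsilon_j(w)\in\mathbb{F}_q .$$ *)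

(* Defs.v *)
From HB Require Import structures.
From mathcomp Require Import all_boot all_order all_algebra.
From mathcomp Require Import boolp classical_sets cardinality fsbigop.

Set Implicit Arguments.
Unset Strict Implicit.
Unset Printing Implicit Defensive.

Import GRing.Theory.
Local Open Scope ring_scope.
Local Open Scope classical_set_scope.

(* The inclusion of F_q in K is a ring morphism iota : F -> K from a finite
   field F, with q = #|F|; families indexed by 1..n are functions on 'I_n, so
   a sign (-1)^(i-1) becomes (-1) ^+ i. *)

Section Residue.
Variable K : fieldType.
Implicit Types (a r : K) (g : {fraction {poly K}}).

Definition fracP (p : {poly K}) : {fraction {poly K}} := FracField.tofrac p.

(* r is the coefficient of (X - a)^-1 in the Laurent expansion of g at a: up to
   a fraction regular at a, g is its principal part at a. *)
Definition is_residue a g r : Prop :=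
  exists (k : nat) (b : nat -> K) (N D : {poly K}),
    D.[a] != 0 /\
    g = fracP r%:P / fracP ('X - a%:P)
        + \sum_(2 <= j < k) fracP (b j)%:P / fracP ('X - a%:P) ^+ j
        + fracP N / fracP D.

Definition residue a g : K := xget 0 [set r | is_residue a g r].

Lemma fracP_neq0 (p : {poly K}) : p != 0 -> fracP p != 0.
Proof. by rewrite /fracP tofrac_eq0. Qed.

Lemma principal_part_uniq (Q0 : fieldType) (phi : {rmorphism {poly K} -> Q0})
    a r s k l (b c : nat -> K) (N D M E : {poly K}) :
  injective phi -> D.[a] != 0 -> E.[a] != 0 ->
  phi r%:P / phi ('X - a%:P)
    + \sum_(2 <= j < k) phi (b j)%:P / phi ('X - a%:P) ^+ j + phi N / phi D =
  phi s%:P / phi ('X - a%:P)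
    + \sum_(2 <= j < l) phi (c j)%:P / phi ('X - a%:P) ^+ j + phi M / phi E ->
  r = s.
Proof.
move=> phi_inj.
have phi_neq0 (p : {poly K}) : p != 0 -> phi p != 0.
  by apply: contraNneq => p0; apply/eqP/phi_inj; rewrite p0 rmorph0.
have pad k0 l0 (b0 : nat -> K) : (k0 <= l0)%N ->
    \sum_(2 <= j < k0) phi (b0 j)%:P / phi ('X - a%:P) ^+ j =
    \sum_(2 <= j < l0)
      phi (if (j < k0)%N then b0 j else 0)%:P / phi ('X - a%:P) ^+ j.
  move=> kl; case: (leqP k0 2) => k2.
    rewrite big_geq // big_nat big1 // => j /andP[j2 _].
    by rewrite ltnNge (leq_trans k2 j2) /= rmorph0 mul0r.
  rewrite (big_cat_nat (ltnW k2) kl) /= [X in _ = _ + X]big_nat.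
  rewrite [X in _ = _ + X]big1 ?addr0.
    by apply: eq_big_nat => j /andP[_ ->].
  by move=> j /andP[kj _]; rewrite ltnNge kj /= rmorph0 mul0r.
move=> Da Ea.
have hk : (k <= (maxn k l).+2)%N by rewrite 2?leqW // leq_maxl.
have hl : (l <= (maxn k l).+2)%N by rewrite 2?leqW // leq_maxr.
rewrite (pad _ _ b hk) (pad _ _ c hl).
set h := (maxn k l).
set b' := fun j => if (j < k)%N then b j else 0.
set c' := fun j => if (j < l)%N then c j else 0.
have [T defT] : exists T : {poly K}, T = 'X - a%:P by exists ('X - a%:P).
rewrite -defT.
have T0 : phi T != 0 by rewrite phi_neq0 // defT polyXsubC_eq0.
have szT m : size (T ^+ m) = m.+1 by rewrite defT size_exp_XsubC.
have D0 : D != 0 by apply: contraNneq Da => ->; rewrite horner0.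
have E0 : E != 0 by apply: contraNneq Ea => ->; rewrite horner0.
have fD0 := phi_neq0 _ D0; have fE0 := phi_neq0 _ E0.
pose Q (e : K) (f : nat -> K) : {poly K} :=
  e%:P * T ^+ h + \sum_(2 <= j < h.+2) (f j)%:P * T ^+ (h.+1 - j).
have QE e f : phi e%:P / phi T
    + \sum_(2 <= j < h.+2) phi (f j)%:P / phi T ^+ j
    = phi (Q e f) / phi T ^+ h.+1.
  rewrite /Q rmorphD rmorphM rmorphXn rmorph_sum mulrDl; congr (_ + _).
    by rewrite exprS invfM mulrA mulrAC mulfK ?expf_neq0.
  rewrite mulr_suml; apply: eq_big_nat => j /andP[_]; rewrite ltnS => jh.
  rewrite rmorphM rmorphXn -{2}(subnK jh) exprD invfM -mulrA; congr (_ * _).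
  by rewrite mulrA mulfV ?expf_neq0 ?mul1r.
rewrite (QE r b') (QE s c') => eqQ.
have {eqQ} eQ : (Q r b' - Q s c') * (D * E) = T ^+ h.+1 * (M * D - N * E).
  apply: (phi_inj); rewrite !(rmorphM, rmorphB, rmorphXn).
  set t := phi T ^+ h.+1 in eqQ *.
  have t0 : t != 0 by rewrite expf_neq0.
  move/(congr1 (fun x => x * (t * (phi D * phi E)))): eqQ.
  have tr (x y d e : Q0) : t != 0 -> d != 0 -> e != 0 ->
      (x / t + y / d) * (t * (d * e)) = x * (d * e) + t * (y * e).
    move=> tn dn en; rewrite mulrDl mulrA divfK // [t * (d * e)]mulrCA.
    by rewrite [y / d * _]mulrA divfK // [y * _]mulrCA.
  rewrite tr // [phi D * phi E]mulrC tr // => eqQ.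
  rewrite mulrBl mulrBr; apply/eqP.
  by rewrite subr_eq addrAC eq_sym subr_eq eqQ addrC.
have dvdT : T ^+ h.+1 %| Q r b' - Q s c'.
  rewrite -(@Gauss_dvdpl _ _ (D * E)); last first.
    apply: coprimep_expl; rewrite coprimep_sym coprimepMl.
    by rewrite defT !coprimep_XsubC /root Da Ea.
  by rewrite eQ dvdp_mulIl.
have szQ (f : nat -> K) :
    (size (\sum_(2 <= j < h.+2) (f j)%:P * T ^+ (h.+1 - j))%R <= h)%N.
  rewrite big_nat; elim/big_ind: _ => [|x y sx sy|j /andP[j2 jh]].
  - by rewrite size_poly0.
  - by rewrite (leq_trans (size_polyD _ _)) // geq_max sx.
  rewrite mul_polyC (leq_trans (size_scale_leq _ _)) // szT.
  case: j j2 jh => [|[|j]] // _; rewrite !ltnS => jh.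
  by rewrite subSS ltn_subrL (leq_trans _ jh).
pose S := \sum_(2 <= j < h.+2) (b' j)%:P * T ^+ (h.+1 - j)
        - \sum_(2 <= j < h.+2) (c' j)%:P * T ^+ (h.+1 - j).
have QS : Q r b' - Q s c' = (r - s) *: T ^+ h + S.
  by rewrite /Q /S -!mul_polyC polyCB mulrBl opprD addrACA.
have szS : (size S <= h)%N.
  rewrite (leq_trans (size_polyD _ _)) // geq_max size_polyN.
  by rewrite !szQ.
have [//|rs] := eqVneq r s; move: dvdT; rewrite QS.
have rs0 : r - s != 0 by rewrite subr_eq0.
have sz : size ((r - s) *: T ^+ h + S) = h.+1.
  by rewrite size_polyDl size_scale // szT // ltnS.
move/dvdp_leq; rewrite sz szT ltnn => H.
by have := H _; rewrite -size_poly_eq0 sz; move=> /(_ isT).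
Qed.

Lemma is_residue_uniq a g r s : is_residue a g r -> is_residue a g s -> r = s.
Proof.
move=> [k [b [N [D [Da ->]]]]] [l [c [M [E [Ea]]]]].
apply: (principal_part_uniq (phi := @FracField.tofrac {poly K})) => // x y /eqP.
by rewrite tofrac_eq => /eqP.
Qed.

Lemma residueP a g r : is_residue a g r -> residue a g = r.
Proof.
move=> gr; apply: xget_unique => // s gs; exact: is_residue_uniq gs gr.
Qed.

End Residue.

Definition moore_det (R : comNzRingType) (q n : nat) (a : 'I_n -> R) : R :=
  \det (\matrix_(i < n, j < n) a j ^+ (q ^ i)).

Section Pairings.
Variables (F : finFieldType) (K : fieldType) (iota : {rmorphism F -> K}).
Local Notation q := #|F|.

Definition is_subspace (W : set K) : Prop :=
  W 0 /\ forall (c : F) (x y : K), W x -> W y -> W (iota c * x + y).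

Definition lincomb (n : nat) (w : 'I_n -> K) (eps : 'I_n -> F) : K :=
  \sum_(i < n) iota (eps i) * w i.

Definition is_basis (n : nat) (W : set K) (w : 'I_n -> K) : Prop :=
  [/\ forall i, W (w i),
      forall x, W x -> exists eps : 'I_n -> F, x = lincomb w eps
    & forall eps : 'I_n -> F, lincomb w eps = 0 -> forall i, eps i = 0].

(* The product is finite as soon as W is, in particular when W has a basis. *)
Definition vanishing_poly (W : set K) : {poly K} :=
  \big[*%R/1]_(x \in W) ('X - x%:P).

Definition qcoef (W : set K) (m : nat) : K := (vanishing_poly W)`_(q ^ m).

Definition reversed_poly (n : nat) (W : set K) : {poly K} :=
  \sum_(m < n.+1) (qcoef W (n - m) ^+ (q ^ m)) *: 'X^(q ^ m).

Definition reversed_roots (n : nat) (W : set K) : set K :=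
  [set u | root (reversed_poly n W) u].

(* The q^m-th root in L of x; it is unique, since q is a power of the
   characteristic of L in the intended use. *)
Definition qroot (L : closedFieldType) (m : nat) (x : L) : L :=
  xget 0 [set y | y ^+ (q ^ m) = x].

(* Computed in an extension L of K meant to be an algebraic closure. *)
Definition elkies_pairing (L : closedFieldType) (jota : {rmorphism K -> L})
    (n : nat) (W : set K) (w u : K) : L :=
  \sum_(1 <= m < n.+1) \sum_(0 <= j < m)
    (qroot m (jota (qcoef W m * u)) * jota w) ^+ (q ^ j).

Definition delta (n : nat) (w : 'I_n -> K) (alpha : 'I_n -> F) : K :=
  \sum_(i < n) iota (alpha i) * (-1) ^+ i
               * moore_det q (fun j : 'I_n.-1 => w (lift i j)).

Definition dual_elt (n : nat) (w : 'I_n -> K) (alpha : 'I_n -> F) : K :=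
  (delta w alpha / moore_det q w) ^+ q.

(* The coordinates alpha of u; they exist and are unique for every root u of the
   reversed polynomial, by Ore's theorem. *)
Definition dual_coord (n : nat) (w : 'I_n -> K) (u : K) : {ffun 'I_n -> F} :=
  xget [ffun=> 0] [set alpha : {ffun 'I_n -> F} | u = dual_elt w alpha].

(* The differential form omega = g dX is represented by its coefficient g. *)
Definition omega (n : nat) (w : 'I_n -> K) (alpha : 'I_n -> F) :
    {fraction {poly K}} :=
  \sum_(eps : {ffun 'I_n -> F})
    fracP (iota (\sum_(j < n) alpha j * eps j))%:P
    / fracP ('X - (lincomb w eps)%:P).

Definition residue_pairing (n : nat) (w : 'I_n -> K) (x u : K) : K :=
  (-1) ^+ n.-1 * residue x (omega w (dual_coord w u)).

Lemma lincomb_inj n (W : set K) (w : 'I_n -> K) (eps eps' : 'I_n -> F) :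
  is_basis W w -> lincomb w eps = lincomb w eps' -> eps =1 eps'.
Proof.
move=> [_ _ free] eqw i; apply/eqP; rewrite -subr_eq0; apply/eqP.
apply: (free (fun i => eps i - eps' i)).
rewrite /lincomb; under eq_bigr do rewrite rmorphB mulrBl.
by rewrite sumrB -!/(lincomb _ _) eqw subrr.
Qed.

(* The closed formula for the residue, which in particular lies in F_q. *)
Lemma residue_omega n (W : set K) (w : 'I_n -> K) (alpha eps : 'I_n -> F) :
  is_basis W w ->
  residue (lincomb w eps) (omega w alpha) =
  iota (\sum_(j < n) alpha j * eps j).
Proof.
move=> bw; apply: residueP; set a := lincomb w eps.
pose e0 : {ffun 'I_n -> F} := [ffun i => eps i].
have ae0 : lincomb w e0 = a by apply: eq_bigr => i _; rewrite ffunE.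
have regular : exists N D : {poly K}, D.[a] != 0 /\
    \sum_(e : {ffun 'I_n -> F} | e != e0)
      fracP (iota (\sum_(j < n) alpha j * e j))%:P
      / fracP ('X - (lincomb w e)%:P) = fracP N / fracP D.
  elim/big_ind: _ => [|x y [N [D [Da ->]]] [M [E [Ea ->]]]|e ee0].
  - by exists 0, 1; rewrite hornerC oner_neq0 /fracP tofrac0 mul0r.
  - exists (N * E + M * D), (D * E); rewrite hornerM mulf_neq0 //; split=> //.
    rewrite addf_div; last 2 first.
    + by apply: fracP_neq0; apply: contraNneq Da => ->; rewrite horner0.
    + by apply: fracP_neq0; apply: contraNneq Ea => ->; rewrite horner0.
    by rewrite /fracP tofracD !tofracM.
  - exists (iota (\sum_(j < n) alpha j * e j))%:P, ('X - (lincomb w e)%:P).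
    split=> //; rewrite hornerXsubC subr_eq0 -ae0.
    apply: contra ee0 => /eqP /(lincomb_inj bw) ee.
    by apply/eqP/ffunP => i; rewrite ee.
have [N [D [Da eqND]]] := regular.
exists 0%N, (fun=> 0), N, D; split=> //.
rewrite big_geq // addr0 /omega (bigD1 e0) //= eqND ae0; congr (_ + _).
congr (fracP (iota _)%:P / _).
by apply: eq_bigr => j _; rewrite ffunE.
Qed.

End Pairings.

(* Main.v *)
(** As a function of [w], the pairing [E(w, u)] is an additive polynomial
[sum_(j < n) e_j w^(q^j)] with [e_(n-1)^q = u].  The difference [E^q - E]
telescopes to [u P_W(w)] minus [w] times a [q^n]-th root of [(rho P_W)(u)], so
[E(w_i, u) = (-1)^(n-1) a_i] with [a_i] in [F_q].  Cramer's rule for the linear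
system [sum_j e_j w_i^(q^j) = (-1)^(n-1) a_i], whose matrix is the Moore matrix,
computes [e_(n-1) = delta_a / Delta], that is, the [a_i] are the coordinates of
[u] defining the residue pairing.  Both pairings are linear in [w] and agree on
the basis. *)

Require Import Defs.
From HB Require Import structures.
From mathcomp Require Import all_boot all_order all_algebra all_field.
From mathcomp Require Import boolp classical_sets cardinality fsbigop.

Set Implicit Arguments.
Unset Strict Implicit.
Unset Printing Implicit Defensive.

Import GRing.Theory.
Local Open Scope ring_scope.
Local Open Scope classical_set_scope.

(** * Powers of the Frobenius and their fixed points *)

Section Frobenius.
Variables (F : finFieldType) (K : fieldType) (iota : {rmorphism F -> K}).
Local Notation q := #|F|.

Lemma pchar_nat_expn_card m : [pchar K].-nat (q ^ m)%N.
Proof.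
have [p pr_p chFp] := finPcharP F.
rewrite (card_pprimeChar chFp) pnatX pnatX pnatE //.
by rewrite (rmorph_pchar iota).
Qed.

Lemma expr_card0 m : 0 ^+ (q ^ m) = 0 :> K.
Proof.
by apply/eqP; rewrite expf_eq0 eqxx expn_gt0 (ltnW (finNzRing_gt1 F)).
Qed.

Lemma expr_card_sum m (I : Type) (r : seq I) (P : pred I) (f : I -> K) :
  (\sum_(i <- r | P i) f i) ^+ (q ^ m) =
  \sum_(i <- r | P i) f i ^+ (q ^ m).
Proof.
apply: (big_morph (fun x => x ^+ (q ^ m))) => [x y|].
  exact: exprDn_pchar (pchar_nat_expn_card m).
exact: expr_card0.
Qed.

Lemma expr_card_inj m : injective (fun x : K => x ^+ (q ^ m)).
Proof.
move=> x y /= /eqP; rewrite -subr_eq0 => /eqP xy.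
apply/eqP; rewrite -subr_eq0.
have : (x - y) ^+ (q ^ m) == 0.
  rewrite exprDn_pchar ?pchar_nat_expn_card //.
  by rewrite exprNn_pchar ?pchar_nat_expn_card // xy.
by rewrite expf_eq0 => /andP[].
Qed.

Lemma expr_card_rmorph m c : iota c ^+ (q ^ m) = iota c.
Proof.
rewrite -rmorphXn; congr (iota _).
by elim: m => [|m IHm]; rewrite ?expr1 // expnSr exprM IHm expf_card.
Qed.

(** Over [F], X^q - X is the product of the X - c; its image under [iota] vanishes at [x], so one of
    the factors does. *)
Lemma expr_card_fixed (x : K) : x ^+ q = x -> exists c, x = iota c.
Proof.
move=> xq; have /(congr1 (fun p => (map_poly iota p).[x])) := finField_genPoly F.
rewrite rmorphB /= map_polyXn map_polyX !hornerE xq subrr.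
rewrite rmorph_prod horner_prod => /esym/eqP/prodf_eq0[c _].
by rewrite rmorphB /= map_polyX map_polyC !hornerE subr_eq0 => /eqP; exists c.
Qed.

Lemma lincomb_expr_card n (w : 'I_n -> K) eps m :
  lincomb iota w eps ^+ (q ^ m) = lincomb iota (fun i => w i ^+ (q ^ m)) eps.
Proof.
by rewrite expr_card_sum; apply: eq_bigr => i _; rewrite exprMn expr_card_rmorph.
Qed.

End Frobenius.

(** * Linearized polynomials, the Moore matrix and the coordinates on U *)

Section Moore.
Variables (F : finFieldType) (K : fieldType) (iota : {rmorphism F -> K}).
Local Notation q := #|F|.

Definition moore_mx n (w : 'I_n -> K) : 'M[K]_n :=
  \matrix_(i < n, j < n) w j ^+ (q ^ i).

Definition qpoly n (v : 'I_n -> K) : {poly K} :=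
  \sum_(k < n) v k *: 'X^(q ^ k).

Lemma horner_qpoly n (v : 'I_n -> K) x :
  (qpoly v).[x] = \sum_k v k * x ^+ (q ^ k).
Proof. by rewrite horner_sum; apply: eq_bigr => k _; rewrite !hornerE. Qed.

Lemma coef_qpoly n (v : 'I_n -> K) (k : 'I_n) : (qpoly v)`_(q ^ k) = v k.
Proof.
rewrite coef_sum (bigD1 k) //= coefZ coefXn eqxx mulr1 big1 ?addr0 // => i ik.
rewrite coefZ coefXn eqn_exp2l ?finNzRing_gt1 // [_ == _ :> nat]eq_sym.
by rewrite (negPf ik : (i == k :> nat) = false) mulr0.
Qed.

Lemma size_qpoly n (v : 'I_n.+1 -> K) : (size (qpoly v) <= (q ^ n).+1)%N.
Proof.
apply: (leq_trans (size_sum _ _ _)); apply/bigmax_leqP => i _.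
rewrite (leq_trans (size_scale_leq _ _)) // size_polyXn ltnS.
by rewrite leq_exp2l ?finNzRing_gt1 // -ltnS.
Qed.

Lemma horner_qpoly_lincomb n m (v : 'I_n -> K) (w : 'I_m -> K) eps :
  (qpoly v).[lincomb iota w eps] = lincomb iota (fun i => (qpoly v).[w i]) eps.
Proof.
rewrite horner_qpoly.
under eq_bigr => k _ do rewrite lincomb_expr_card mulr_sumr.
rewrite exchange_big; apply: eq_bigr => i _ /=.
rewrite horner_qpoly mulr_sumr; apply: eq_bigr => k _.
by rewrite mulrCA.
Qed.

Definition span_seq n (w : 'I_n -> K) : seq K :=
  [seq lincomb iota w eps | eps : {ffun 'I_n -> F}].

Lemma size_span_seq n (w : 'I_n -> K) : size (span_seq w) = (q ^ n)%N.
Proof. by rewrite size_map -cardE card_ffun card_ord. Qed.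

Section Basis.
Variables (n : nat) (W : set K) (w : 'I_n.+1 -> K).
Hypothesis w_basis : is_basis iota W w.

Lemma uniq_span_seq : uniq (span_seq w).
Proof.
rewrite map_inj_uniq ?enum_uniq // => e e' /(lincomb_inj w_basis) ee.
exact/ffunP.
Qed.

Lemma root_qpoly_span_seq m (v : 'I_m -> K) :
  (forall i, (qpoly v).[w i] = 0) -> all (root (qpoly v)) (span_seq w).
Proof.
move=> vw; apply/allP => _ /mapP[e _ ->]; rewrite /root horner_qpoly_lincomb.
by rewrite /lincomb big1 // => i _; rewrite vw mulr0.
Qed.

(** A left kernel vector is the coefficient list of a linearized polynomial of degree at most q^n
    vanishing on the q^(n+1) elements of the span, hence zero. *)
Lemma moore_mx_unit : moore_mx w \in unitmx.
Proof.
rewrite -row_free_unit -kermx_eq0; apply/rowV0P => v /sub_kermxP vM.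
pose Q := qpoly (fun k => v 0 k).
have Q0 : Q = 0.
  apply/eqP; apply: contraT => /max_poly_roots/(_ _ uniq_span_seq).
  rewrite size_span_seq => /(_ _)/wrap[].
    apply: root_qpoly_span_seq => i; rewrite horner_qpoly.
    move/rowP: vM => /(_ i); rewrite !mxE => vMi; rewrite -[RHS]vMi.
    by apply: eq_bigr => k _; rewrite mxE.
  move=> /leq_trans/(_ (size_qpoly _)); rewrite ltnS leq_exp2l ?finNzRing_gt1 //.
  by rewrite ltnn.
by apply/rowP => k; rewrite mxE -(coef_qpoly (fun k => v 0 k)) -/Q Q0 coef0.
Qed.

Lemma vanishing_poly_prod : is_subspace iota W ->
  vanishing_poly W = \prod_(z <- span_seq w) ('X - z%:P).
Proof.
move=> [W0 WD]; rewrite fsbig_seq ?uniq_span_seq // /vanishing_poly.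
congr (\big[_/_]_(y \in _) _); apply/seteqP; split=> y /=.
  have [_ W_span _] := w_basis; move=> /W_span[eps ->].
  apply/mapP; exists [ffun i => eps i]; first by rewrite mem_enum.
  by apply: eq_bigr => i _; rewrite ffunE.
move=> /mapP[eps _ ->]; have [Ww _ _] := w_basis.
rewrite /lincomb; elim/big_rec: _ => // i z _ Wz; exact: WD.
Qed.

Lemma qcoef_lead : is_subspace iota W -> qcoef F W n.+1 = 1.
Proof.
move=> /vanishing_poly_prod WE; rewrite /qcoef WE.
have := monic_prod_XsubC (span_seq w) predT id => /monicP.
by rewrite lead_coefE size_prod_XsubC size_span_seq.
Qed.

(** A monic polynomial of degree q^(n+1) vanishing on the span must be P_W, so it suffices to build
    a linearized one. *)
Lemma vanishing_polyE : is_subspace iota W ->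
  vanishing_poly W = qpoly (fun m : 'I_n.+2 => qcoef F W m).
Proof.
move=> /vanishing_poly_prod WE.
(* With this [e], X^(q^(n+1)) - sum_k e_k X^(q^k) vanishes at every w_i; [v] lists its
   coefficients. *)
have [e eM] : exists e : 'rV[K]_n.+1,
    e *m moore_mx w = \row_i (w i ^+ (q ^ n.+1)).
  exists (\row_i (w i ^+ (q ^ n.+1)) *m invmx (moore_mx w)).
  by rewrite mulmxKV // moore_mx_unit.
pose v (m : 'I_n.+2) := if unlift ord_max m is Some k then - e 0 k else 1.
suff PQ : vanishing_poly W = qpoly v.
  by rewrite PQ; apply: eq_bigr => m _; rewrite /qcoef PQ coef_qpoly.
have vmax : v ord_max = 1 by rewrite /v unlift_none.
have szv : size (qpoly v) = (q ^ n.+1).+1.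
  apply/eqP; rewrite eqn_leq size_qpoly ltnNge; apply/negP.
  move=> /leq_sizeP/(_ _ (leqnn _))/eqP.
  by rewrite (coef_qpoly v ord_max) vmax oner_eq0.
have rv : all (root (qpoly v)) (span_seq w).
  apply: root_qpoly_span_seq => i; rewrite horner_qpoly big_ord_recr /= vmax.
  rewrite mul1r; apply/eqP; rewrite addrC addr_eq0; apply/eqP.
  move/rowP: eM => /(_ i); rewrite !mxE => <-; rewrite -sumrN.
  apply: eq_bigr => k _; rewrite mxE /v.
  have -> : widen_ord (leqnSn n.+1) k = lift ord_max k.
    by apply/val_inj; rewrite /= /bump leqNgt ltn_ord.
  by rewrite liftK mulNr opprK.
have := @all_roots_prod_XsubC _ (qpoly v) (span_seq w).
rewrite size_span_seq uniq_rootsE => /(_ szv rv uniq_span_seq) ->.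
by rewrite lead_coefE szv /= (coef_qpoly v ord_max) vmax scale1r.
Qed.

Lemma vanishing_poly_root x : is_subspace iota W -> W x ->
  (vanishing_poly W).[x] = 0.
Proof.
move=> /vanishing_poly_prod WE; have [_ W_span _] := w_basis => /W_span[eps xE].
apply/eqP; rewrite WE -[_ == 0]/(root _ _) root_prod_XsubC; apply/mapP.
exists [ffun i => eps i]; first by rewrite mem_enum.
by rewrite xE; apply: eq_bigr => i _; rewrite ffunE.
Qed.

Lemma moore_invmx_col k (i0 := ord_max : 'I_n.+1) : (k <= n)%N ->
  \sum_i w i ^+ (q ^ k) * invmx (moore_mx w) i i0 = (k == n)%:R.
Proof.
rewrite -ltnS => kn; have := mulmxV moore_mx_unit.
move/matrixP => /(_ (Ordinal kn) i0); rewrite !mxE => <-.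
by apply: eq_bigr => i _; rewrite !mxE.
Qed.

(** The last column of the inverse consists of cofactors of the last row over the determinant;
    removing that row and column i leaves the Moore matrix of the w_j with j != i. The factor (-1)^n
    turns the cofactor sign (-1)^(n+i) into (-1)^i. *)
Lemma delta_invmx alpha :
  delta iota w alpha / moore_det q w =
  \sum_i iota (alpha i) * ((-1) ^+ n * invmx (moore_mx w) i ord_max).
Proof.
rewrite /delta mulr_suml; apply: eq_bigr => i _; rewrite -!mulrA.
congr (_ * _); rewrite /invmx moore_mx_unit !mxE /cofactor.
rewrite [X in _ = _ * X]mulrCA [RHS]mulrA -exprD /=.
rewrite addnA addnn exprD -mul2n exprM sqrrN expr1n expr1n mul1r.
rewrite [in RHS](mulrC _^-1); congr (_ * (\det _ / _)).
apply/matrixP => k j; rewrite !mxE.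
by rewrite /= /bump leqNgt ltn_ord.
Qed.

(* The Moore matrix of the q^n-th powers of w times the transposed Moore matrix of
   the last column of (moore_mx w)^-1 is unitriangular. *)
Lemma invmx_col_free (gamma : 'I_n.+1 -> F) :
  lincomb iota (fun i => invmx (moore_mx w) i ord_max) gamma = 0 ->
  forall i, gamma i = 0.
Proof.
set b := fun i => _ => gb.
pose B : 'M[K]_n.+1 := \matrix_(i, l) b i ^+ (q ^ l).
pose N : 'M[K]_n.+1 := \matrix_(k, i) w i ^+ (q ^ (k + n)).
have NB (k l : 'I_n.+1) : (k <= l)%N -> (N *m B) k l = (k == l)%:R.
  move=> kl.
  have lkn : (l <= k + n)%N by rewrite (leq_trans (leq_ord l)) ?leq_addl.
  rewrite mxE.
  (* Factoring out the q^l-th power leaves the exponent k + n - l, which is at most n because k <=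
     l, and equals n exactly on the diagonal. *)
  transitivity ((\sum_i w i ^+ (q ^ (k + n - l)) * b i) ^+ (q ^ l)).
    rewrite (expr_card_sum iota); apply: eq_bigr => i _.
    by rewrite !mxE exprMn -exprM -expnD subnK.
  rewrite moore_invmx_col; last first.
    by rewrite leq_subLR leq_add2r.
  rewrite -(rmorph_nat iota) (expr_card_rmorph iota) rmorph_nat; congr _%:R.
  rewrite -(eqn_add2r l) subnK // addnC eqn_add2l; congr nat_of_bool.
have B_unit : B \in unitmx.
  have : \det (N *m B) != 0.
    rewrite det_trig; last first.
      by apply/is_trig_mxP => k l kl; rewrite NB ?(ltnW kl) // -val_eqE ltn_eqF.
    by apply/prodf_neq0 => k _; rewrite NB // eqxx oner_neq0.
  by rewrite det_mulmx mulf_eq0 negb_or unitmxE unitfE => /andP[].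
have gB : (\row_i iota (gamma i)) *m B = 0.
  apply/rowP => l; rewrite !mxE.
  have /(congr1 (fun x => x ^+ (q ^ l))) := gb.
  rewrite lincomb_expr_card expr_card0 => H0; rewrite -[RHS]H0.
  by apply: eq_bigr => i _; rewrite !mxE.
move=> i; apply: (fmorph_inj iota); rewrite rmorph0.
have /(congr1 (mulmx^~ (invmx B))) := gB.
by rewrite mul0mx mulmxK // => /rowP/(_ i); rewrite !mxE.
Qed.

(** After cancelling the Frobenius, the difference of the two sides is an F_q-linear relation
    between the entries of the last column of the inverse. This is the uniqueness needed to evaluate
    [dual_coord]. *)
Lemma dual_elt_inj (alpha alpha' : {ffun 'I_n.+1 -> F}) :
  dual_elt iota w alpha = dual_elt iota w alpha' -> alpha = alpha'.
Proof.
rewrite /dual_elt -[in X in X -> _](expn1 q) => /(expr_card_inj iota).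
rewrite !delta_invmx => /eqP; rewrite -subr_eq0 -sumrB => /eqP aa'.
apply/ffunP => i; apply/eqP; rewrite -subr_eq0; apply/eqP.
apply: (@invmx_col_free (fun i => alpha i - alpha' i)).
have sign_neq0 : (-1) ^+ n != 0 :> K by rewrite signr_eq0.
apply: (mulfI sign_neq0); rewrite mulr0 -[RHS]aa' mulr_sumr.
by apply: eq_bigr => j _; rewrite -mulrBl -rmorphB mulrCA.
Qed.

End Basis.
End Moore.

(** * The Elkies pairing as a linearized polynomial, and its values on the basis *)

Section Elkies.
Variables (F : finFieldType) (K : fieldType) (iota : {rmorphism F -> K}).
Variables (L : closedFieldType) (jota : {rmorphism K -> L}).
Local Notation q := #|F|.
Local Notation kappa := (jota \o iota : {rmorphism F -> L}).

(** X^(q^m) - x has a root in the closed field [L], so the default value 0 in [qroot] is never taken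
    by accident. *)
Lemma qrootK m (x : L) : qroot F m x ^+ (q ^ m) = x.
Proof.
apply: (@xgetPex _ 0 [set y | y ^+ (q ^ m) = x]).
have qm_gt0 : (0 < q ^ m)%N by rewrite expn_gt0 (ltnW (finNzRing_gt1 F)).
have /closed_rootP[y] : size ('X^(q ^ m) - x%:P) != 1%N.
  by rewrite size_XnsubC // eqSS -lt0n.
by rewrite /root !hornerE subr_eq0 => /eqP; exists y.
Qed.

Lemma rmorph_lincomb n (w : 'I_n -> K) eps :
  jota (lincomb iota w eps) = lincomb kappa (fun i => jota (w i)) eps.
Proof. by rewrite rmorph_sum; apply: eq_bigr => i _; rewrite rmorphM. Qed.

Variables (n : nat) (W : set K) (w : 'I_n.+1 -> K) (u : K).
Hypotheses (W_subspace : is_subspace iota W) (w_basis : is_basis iota W w).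
Hypothesis Uu : reversed_roots F n.+1 W u.

Let r m := qroot F m (jota (qcoef F W m * u)).

(** The coefficient of w^(q^j) in E(w, u) once the two sums are exchanged. *)
Definition elkies_coef (j : 'I_n.+1) : L :=
  \sum_(m < n.+2 | (j < m)%N) r m ^+ (q ^ j).

Local Notation E x := (elkies_pairing F jota n.+1 W x u).

(** The added term m = 0 is an empty sum; it makes m range over all coefficients of P_W. *)
Lemma elkies_pairing_sum x :
  E x = \sum_(m < n.+2) \sum_(0 <= j < m) (r m * jota x) ^+ (q ^ j).
Proof.
rewrite -(big_mkord predT (fun m => \sum_(0 <= j < m) (r m * jota x) ^+ (q ^ j))).
rewrite /elkies_pairing big_add1 [RHS]big_nat_recl //.
by rewrite [X in _ = X + _]big_geq // add0r.
Qed.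

Lemma elkies_pairing_qpoly x : E x = (qpoly F elkies_coef).[jota x].
Proof.
rewrite elkies_pairing_sum horner_qpoly.
transitivity (\sum_(m < n.+2) \sum_(j < n.+1 | (j < m)%N)
    r m ^+ (q ^ j) * jota x ^+ (q ^ j)).
  apply: eq_bigr => m _; rewrite (big_nat_widen _ _ n.+1) 1?leq_ord //=.
  rewrite big_mkord; apply: eq_bigr => j _; exact: exprMn.
rewrite (exchange_big_dep predT) //=.
by apply: eq_bigr => j _; rewrite mulr_suml.
Qed.

Lemma elkies_pairing_lincomb eps :
  E (lincomb iota w eps) = lincomb kappa (fun i => E (w i)) eps.
Proof.
rewrite elkies_pairing_qpoly rmorph_lincomb horner_qpoly_lincomb.
by apply: eq_bigr => i _; rewrite elkies_pairing_qpoly.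
Qed.

Lemma sum_qroot_eq0 : \sum_(m < n.+2) r m = 0.
Proof.
apply: (@expr_card_inj F L kappa n.+1) => /=.
rewrite (expr_card_sum kappa) expr_card0.
move: Uu; rewrite /reversed_roots /= /root horner_sum => /eqP.
move=> /(congr1 jota); rewrite rmorph0 => H0; rewrite -[RHS]H0.
(* Since (r_(n+1-m))^(q^(n+1)) = (c_(n+1-m) u)^(q^m), reversing the order of summation matches the
   terms of (rho P_W)(u). *)
rewrite rmorph_sum (reindex_inj rev_ord_inj); apply: eq_bigr => m _ /=.
rewrite !hornerE -exprMn rmorphXn subSS.
have mn : (m <= n.+1)%N by rewrite -ltnS.
by rewrite -[X in (q ^ X)%N](subnK mn) expnD exprM qrootK.
Qed.

(* E(x)^q - E(x) telescopes to u P_W(x) - x * sum_m (c_m u)^(q^-m), and the last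
   sum is a q^(n+1)-th root of (rho P_W)(u). *)
Lemma elkies_pairing_fixed x : W x -> E x ^+ q = E x.
Proof.
move=> Wx; apply/eqP; rewrite -subr_eq0 elkies_pairing_sum.
rewrite -[X in _ ^+ X - _](expn1 q) (expr_card_sum kappa) -sumrB.
under eq_bigr => m _.
  rewrite (expr_card_sum kappa) -sumrB.
  under eq_bigr => j _ do rewrite -exprM -expnD addn1.
  rewrite telescope_sumr // expn0 expr1 exprMn qrootK rmorphM.
  over.
rewrite sumrB -mulr_suml sum_qroot_eq0 mul0r subr0.
have := vanishing_poly_root w_basis W_subspace Wx.
rewrite (vanishing_polyE w_basis) // horner_qpoly.
move=> /(congr1 (fun y => jota (y * u))); rewrite mul0r rmorph0 => H0.
apply/eqP; rewrite -[RHS]H0.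
rewrite mulr_suml rmorph_sum; apply: eq_bigr => m _.
by rewrite mulrAC !rmorphM rmorphXn.
Qed.

Lemma dual_elt_elkies_pairing (a : {ffun 'I_n.+1 -> F}) :
  (forall i, E (w i) = (-1) ^+ n * kappa (a i)) -> u = dual_elt iota w a.
Proof.
move=> Ea; apply: (fmorph_inj jota).
(* Only m = n+1 exceeds j = n, so the top coefficient is the q^(n+1)-th root of c_(n+1) u = u,
   raised to the power q^n. *)
transitivity (elkies_coef ord_max ^+ q).
  rewrite /elkies_coef (big_pred1 ord_max) => [|m]; last first.
    by rewrite /= -val_eqE eqn_leq /= leq_ord.
  rewrite -exprM -expnSr qrootK.
  by rewrite (qcoef_lead w_basis W_subspace) mul1r.
rewrite rmorphXn; congr (_ ^+ _); rewrite (delta_invmx w_basis).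
(* The coefficients solve the Moore system with right-hand side E(w_i, u); its last unknown involves
   only the last column of the inverse. *)
pose e := \row_j elkies_coef j.
have eM : e *m map_mx jota (moore_mx F w) = \row_i E (w i).
  apply/rowP => i; rewrite !mxE elkies_pairing_qpoly horner_qpoly.
  by apply: eq_bigr => k _; rewrite !mxE rmorphXn.
have /(congr1 (mulmx^~ (map_mx jota (invmx (moore_mx F w))))) := eM.
rewrite -mulmxA -map_mxM mulmxV ?(moore_mx_unit w_basis) // map_mx1 mulmx1.
move=> /rowP/(_ ord_max); rewrite !mxE => ->; rewrite rmorph_sum.
apply: eq_bigr => i _; rewrite !mxE Ea !rmorphM rmorph_sign.
by rewrite -mulrA mulrCA.
Qed.

(** Gives the existence of the coordinates of [u]: they are the signed values of the pairing on the
    basis, which the Frobenius fixes. *)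
Lemma elkies_pairing_coord :
  exists2 a : {ffun 'I_n.+1 -> F}, u = dual_elt iota w a
    & forall i, E (w i) = (-1) ^+ n * kappa (a i).
Proof.
have [Ww _ _] := w_basis.
have fixedE i : exists c, (-1) ^+ n * E (w i) = kappa c.
  apply: expr_card_fixed; rewrite exprMn elkies_pairing_fixed //.
  (* As the image of an element of [F], the sign is fixed by the q-th power in every
     characteristic. *)
  have -> : (-1) ^+ n = kappa ((-1) ^+ n) by rewrite rmorph_sign.
  by rewrite -{1}(expn1 q) expr_card_rmorph.
have /choice[a aE] := fixedE.
have Ea i : E (w i) = (-1) ^+ n * kappa ([ffun i => a i] i).
  by rewrite ffunE -aE mulrA -expr2 sqrr_sign mul1r.
by exists [ffun i => a i]; first exact: dual_elt_elkies_pairing.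
Qed.

End Elkies.

Theorem proposition3p2
  (F : finFieldType) (K : fieldType) (iota : {rmorphism F -> K})
  (L : closedFieldType) (jota : {rmorphism K -> L})
  (L_algebraic : forall x : L, algebraicOver jota x)
  (n : nat) (n_gt0 : (0 < n)%N)
  (W : set K) (W_subspace : is_subspace iota W)
  (w : 'I_n -> K) (w_basis : is_basis iota W w)
  (x u : K) (Wx : W x) (Uu : reversed_roots F n W u) :
  elkies_pairing F jota n W x u = jota (residue_pairing iota w x u).
Proof.
case: n n_gt0 w w_basis Uu => // n _ w w_basis Uu.
have [a ua Ea] := elkies_pairing_coord jota W_subspace w_basis Uu.
(* Existence of [a] and injectivity of [dual_elt] determine the choice made by [xget]. *)
have coord_u : dual_coord iota w u = a.
  by apply: xget_unique => // b; rewrite /= {1}ua => /(dual_elt_inj w_basis).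
have [_ W_span _] := w_basis; have [eps ->] := W_span _ Wx.
rewrite (elkies_pairing_lincomb iota).
rewrite /residue_pairing coord_u (residue_omega _ _ w_basis) rmorphM rmorph_sign.
rewrite !rmorph_sum mulr_sumr; apply: eq_bigr => i _.
by rewrite Ea !rmorphM mulrCA [X in _ * X]mulrC.
Qed.
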